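(* Consider the delayed constrained online convex optimization problem and the DTC-OCO algorithm with feedback delay $\tau\ge 1$ described in the context, and suppose Assumptions 1, 2 and 3 of the context hold. Then for any $\alpha,\gamma>0$ and $\eta\ge\gamma^2\beta^2$, the dynamic regret $\mathrm{RE}_{\mathrm d}(T)=\sum_{t=1}^{T}[f_t(\mathbf{x}_t)-f_t(\mathbf{x}_t^\star)]$ of DTC-OCO is upper bounded by $$\mathrm{RE}_{\mathrm d}(T)\le\frac{D^2}{4\alpha}T+\frac{\gamma^2G^2}{2}+\gamma^2\Delta_{\mathbf g}+(\alpha\tau+\eta)\left(R^2+2R\Delta_{\mathbf{x}^\star}\right)+DR\tau .$$
   Context: Problem data. $T\ge1$ is the time horizon and $\tau\ge1$ an integer (feedback delay). $\mathcal{X}_0\subseteq\mathbb{R}^n$ is a compact convex set. For $t=1,2,\dots$, $f_t:\mathbb{R}^n\to\mathbb{R}$ is a convex differentiable loss function and $\mathbf{g}_t=[g_t^1,\dots,g_t^C]^T:\mathbb{R}^n\to\mathbb{R}^C$ is a constraint function with each component $g_t^c$ convex, $c\in\mathcal{C}=\{1,\dots,C\}$. $\preceq,\succeq$ are entrywise inequalities. Assumptions. (1) There is $D>0$ with $\|\nabla f_t(\mathbf{x})\|_2\le D$ for all $\mathbf{x}\in\mathcal{X}_0$ and all $t$. (2.1) There is $\beta>0$ with $\|\mathbf{g}_t(\mathbf{x})-\mathbf{g}_t(\mathbf{y})\|_2\le\beta\|\mathbf{x}-\mathbf{y}\|_2$ for all $\mathbf{x},\mathbf{y}\in\mathcal{X}_0$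 and all $t$. (2.2) There is $G>0$ with $\|\mathbf{g}_t(\mathbf{x})\|_2\le G$ for all $\mathbf{x}\in\mathcal{X}_0$ and all $t$. (2.3) There is $\epsilon>0$ such that for every $t$ there is $\tilde{\mathbf{x}}_t\in\mathcal{X}_0$ with $\mathbf{g}_t(\tilde{\mathbf{x}}_t)\preceq-\epsilon\mathbf{1}$. (3) There is $R>0$ with $\|\mathbf{x}-\mathbf{y}\|_2\le R$ for all $\mathbf{x},\mathbf{y}\in\mathcal{X}_0$. DTC-OCO algorithm with parameters $\alpha,\eta,\gamma>0$. Initialization: $\mathbf{x}_t\in\mathcal{X}_0$ arbitrary and $\mathbf{Q}_t=\mathbf{0}\in\mathbb{R}^C$ for $1\le t\le\tau$, and $\mathbf{g}_0(\mathbf{x})\equiv\mathbf{0}$. For each $t>\tau$: first, $\mathbf{x}_t$ is the minimizer over $\mathbf{x}\in\mathcal{X}_0$ of $$[\nabla f_{t-\tau}(\mathbf{x}_{t-\tau})]^T(\mathbf{x}-\mathbf{x}_{t-\tau})+[\mathbf{Q}_{t-1}+\gamma\mathbf{g}_{t-\tau-1}(\mathbf{x}_{t-1})]^T[\gamma\mathbf{g}_{t-\tau}(\mathbf{x})]+\alpha\|\mathbf{x}-\mathbf{x}_{t-\tau}\|_2^2+\eta\|\mathbf{x}-\mathbf{x}_{t-1}\|_2^2;$$ then the virtual queue $\mathbf{Q}_t=[Q_t^1,\dots,Q_t^C]^T$ is updated for each $c\in\mathcal{C}$ by $Q_t^c=\max\{-\gamma g_{t-\tau}^c(\mathbf{x}_t),\,Q_{t-1}^c+\gamma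 g_{t-\tau}^c(\mathbf{x}_t)\}$. Benchmark and variation measures. $\mathbf{x}_t^\star\in\arg\min_{\mathbf{x}\in\mathcal{X}_0}\{f_t(\mathbf{x}) : \mathbf{g}_t(\mathbf{x})\preceq\mathbf{0}\}$ for $t\ge1$ (any choice of minimizer), and $\mathbf{x}_0^\star$ is an arbitrary point of $\mathcal{X}_0$. $\Delta_{\mathbf{x}^\star}=\sum_{t=1}^T\|\mathbf{x}_t^\star-\mathbf{x}_{t-1}^\star\|_2$ and $\Delta_{\mathbf g}=\sum_{t=1}^T\max_{\mathbf{x}\in\mathcal{X}_0}\|\mathbf{g}_t(\mathbf{x})-\mathbf{g}_{t-1}(\mathbf{x})\|_2^2$. *)

(* Defs.v *)
From HB Require Import structures.
From mathcomp Require Import all_boot all_order all_algebra.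
From mathcomp Require Import all_classical all_reals all_analysis.

Set Implicit Arguments.
Unset Strict Implicit.
Unset Printing Implicit Defensive.

Import Order.TTheory GRing.Theory Num.Theory.
Import numFieldNormedType.Exports.

Local Open Scope classical_set_scope.
Local Open Scope ring_scope.

Definition dot (R : realType) (n : nat) (u v : 'rV[R]_n) : R :=
  \sum_(i < n) u 0 i * v 0 i.

(* The canonical norm `|u| on 'rV[R]_n is the sup norm, so the Euclidean norm
   is introduced separately (both norms induce the same topology, which is what
   [compact] and [differentiable] refer to). *)
Definition norm2 (R : realType) (n : nat) (u : 'rV[R]_n) : R :=
  Num.sqrt (dot u u).

Definition gradient (R : realType) (n : nat) (f : 'rV[R]_n -> R)
    (x : 'rV[R]_n) : 'rV[R]_n :=
  \row_(i < n) 'D_(delta_mx 0 i) f x.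

Definition argmin (R : realType) (V : Type) (A : set V) (h : V -> R) : set V :=
  [set x | A x /\ forall y, A y -> h x <= h y].

Definition dtc_oco_objective (R : realType) (n C : nat) (tau : nat)
    (f : nat -> 'rV[R]_n -> R) (g : nat -> 'rV[R]_n -> 'rV[R]_C)
    (alpha eta gamma : R) (x : nat -> 'rV[R]_n) (Q : nat -> 'rV[R]_C)
    (t : nat) (y : 'rV[R]_n) : R :=
  let s := (t - tau)%N in
  dot (gradient (f s) (x s)) (y - x s)
  + dot (Q t.-1 + gamma *: g s.-1 (x t.-1)) (gamma *: g s y)
  + alpha * norm2 (y - x s) ^+ 2
  + eta * norm2 (y - x t.-1) ^+ 2.

(* Rounds are numbered from 1: [x 0] and [Q 0] are never read. Index 0 of [g]
   is the initialization g_0 = 0 rather than an actual constraint, and index 0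
   of [f] is never read. *)
Record dtc_oco (R : realType) (n C : nat) (tau : nat) (X0 : set 'rV[R]_n)
    (f : nat -> 'rV[R]_n -> R) (g : nat -> 'rV[R]_n -> 'rV[R]_C)
    (alpha eta gamma : R) (x : nat -> 'rV[R]_n) (Q : nat -> 'rV[R]_C) : Prop :=
  DtcOco {
    dtc_oco_init_x : forall t, (1 <= t <= tau)%N -> X0 (x t);
    dtc_oco_init_Q : forall t, (1 <= t <= tau)%N -> Q t = 0;
    dtc_oco_init_g : forall y, g 0%N y = 0;
    dtc_oco_decision : forall t, (tau < t)%N ->
      argmin X0 (dtc_oco_objective tau f g alpha eta gamma x Q t) (x t);
    dtc_oco_queue : forall t, (tau < t)%N -> forall c,
      Q t 0 c = Num.max (- (gamma * g (t - tau)%N (x t) 0 c))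
                        (Q t.-1 0 c + gamma * g (t - tau)%N (x t) 0 c)
  }.

Definition dynamic_benchmark (R : realType) (n C : nat) (X0 : set 'rV[R]_n)
    (f : nat -> 'rV[R]_n -> R) (g : nat -> 'rV[R]_n -> 'rV[R]_C)
    (xs : nat -> 'rV[R]_n) : Prop :=
  X0 (xs 0%N) /\
  forall t, (1 <= t)%N ->
    argmin [set y | X0 y /\ forall c, g t y 0 c <= 0] (f t) (xs t).

Definition dynamic_regret (R : realType) (n : nat)
    (f : nat -> 'rV[R]_n -> R) (x xs : nat -> 'rV[R]_n) (T : nat) : R :=
  \sum_(1 <= t < T.+1) (f t (x t) - f t (xs t)).

Definition path_length (R : realType) (n : nat) (xs : nat -> 'rV[R]_n)
    (T : nat) : R :=
  \sum_(1 <= t < T.+1) norm2 (xs t - xs t.-1).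

(* The supremum is a maximum whenever [X0] is compact and nonempty and each
   [g t] is continuous on [X0]. *)
Definition constraint_variation (R : realType) (n C : nat) (X0 : set 'rV[R]_n)
    (g : nat -> 'rV[R]_n -> 'rV[R]_C) (T : nat) : R :=
  \sum_(1 <= t < T.+1) sup [set norm2 (g t y - g t.-1 y) ^+ 2 | y in X0].

(* Main.v *)
(** By strong convexity of the per-round objective, its minimizer [x_t]
    satisfies, with [s = t - tau],
      [obj x_t + (alpha + eta) |x*_s - x_t|^2 <= obj x*_s].
    The weights [Q_(t-1) + gamma g_(s-1)(x_(t-1))] are nonnegative by the queue
    update and [g_s x*_s <= 0], so the constraint term of [obj x*_s] is dropped.
    With [a_t = gamma g_(t-tau)(x_t)] the queue drift gives
      [- (Q_(t-1) + a_(t-1)).a_t <= (|Q_(t-1)|^2 - |Q_t|^2) / 2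
         + (|a_t|^2 - |a_(t-1)|^2) / 2 + |a_t - a_(t-1)|^2 / 2],
    whose last term is absorbed by [eta |x_t - x_(t-1)|^2] up to the variation
    of [g]. Summing over [s = 1 .. T], that is over rounds up to [T + tau],
    the [eta] differences telescope up to the drift of [x*], and the [alpha]
    differences split into [tau] sums of the same kind. *)

Require Import Defs.
From HB Require Import structures.
From mathcomp Require Import all_boot all_order all_algebra.
From mathcomp Require Import all_classical all_reals all_analysis.
From mathcomp Require Import ring lra.

Set Implicit Arguments.
Unset Strict Implicit.
Unset Printing Implicit Defensive.

Import Order.TTheory GRing.Theory Num.Theory.
Import numFieldNormedType.Exports.

Local Open Scope classical_set_scope.
Local Open Scope ring_scope.

(** * Euclidean inner product and Cauchy-Schwarz *)

Section Euclidean.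
Variables (R : realType) (n : nat).
Implicit Types (u v w : 'rV[R]_n) (k : R).

Lemma dotC u v : dot u v = dot v u.
Proof. by apply: eq_bigr => i _; rewrite mulrC. Qed.

Lemma dotDl u v w : dot (u + v) w = dot u w + dot v w.
Proof. by rewrite /dot -big_split; apply: eq_bigr => i _; rewrite mxE mulrDl. Qed.

Lemma dotZl k u v : dot (k *: u) v = k * dot u v.
Proof. by rewrite /dot mulr_sumr; apply: eq_bigr => i _; rewrite mxE mulrA. Qed.

Lemma dotNl u v : dot (- u) v = - dot u v.
Proof. by rewrite -scaleN1r dotZl mulN1r. Qed.

Lemma dotDr u v w : dot u (v + w) = dot u v + dot u w.
Proof. by rewrite dotC dotDl !(dotC u). Qed.

Lemma dotZr k u v : dot u (k *: v) = k * dot u v.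
Proof. by rewrite dotC dotZl dotC. Qed.

Lemma dotNr u v : dot u (- v) = - dot u v.
Proof. by rewrite dotC dotNl dotC. Qed.

Definition dotE := (dotDl, dotDr, dotNl, dotNr, dotZl, dotZr).

Lemma dot_sqrB u v : dot (u - v) (u - v) = dot u u - 2 * dot u v + dot v v.
Proof. by rewrite !dotE (dotC v u); ring. Qed.

Lemma dot_ge0 u : 0 <= dot u u.
Proof. by apply: sumr_ge0 => i _; rewrite -expr2 sqr_ge0. Qed.

Lemma norm2_ge0 u : 0 <= norm2 u.
Proof. exact: sqrtr_ge0. Qed.

Lemma sqr_norm2 u : norm2 u ^+ 2 = dot u u.
Proof. by rewrite sqr_sqrtr ?dot_ge0. Qed.

Lemma sqr_norm2_le u k : norm2 u <= k -> dot u u <= k ^+ 2.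
Proof.
move=> uk; have k0 := le_trans (norm2_ge0 u) uk.
by rewrite -sqr_norm2 lerXn2r ?nnegrE ?norm2_ge0.
Qed.

Lemma norm2_eq0 u : norm2 u = 0 -> u = 0.
Proof.
move=> u0; have /esym/eqP := sqr_norm2 u.
rewrite u0 expr0n/= /dot psumr_eq0 => [/allP u00|j _];
  last by rewrite -expr2 sqr_ge0.
apply/rowP => i; rewrite mxE; apply/eqP; rewrite -sqrf_eq0 expr2.
exact: (u00 i (mem_index_enum i)).
Qed.

Lemma dot_young k u v : 0 < k -> dot u v <= dot u u / (4 * k) + k * dot v v.
Proof.
move=> k0; rewrite -subr_ge0.
have -> : dot u u / (4 * k) + k * dot v v - dot u v =
    dot (u - (2 * k) *: v) (u - (2 * k) *: v) / (4 * k).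
  by rewrite !dotE (dotC v u); field; rewrite gt_eqF.
by rewrite divr_ge0 ?dot_ge0// mulr_ge0 ?ltW.
Qed.

Lemma dot_le_norm2 u v : dot u v <= norm2 u * norm2 v.
Proof.
have [/norm2_eq0 ->|v0] := eqVneq (norm2 v) 0.
  by rewrite -(scale0r 0) dotZr mul0r mulr_ge0 ?norm2_ge0.
have [/norm2_eq0 ->|u0] := eqVneq (norm2 u) 0.
  by rewrite -(scale0r 0) dotZl mul0r mulr_ge0 ?norm2_ge0.
have up : 0 < norm2 u by rewrite lt_def u0 norm2_ge0.
have vp : 0 < norm2 v by rewrite lt_def v0 norm2_ge0.
(* With this weight the two terms of Young's bound coincide, each being [norm2 u * norm2 v / 2]. *)
have k0 : 0 < norm2 u / (2 * norm2 v) by rewrite divr_gt0 ?mulr_gt0.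
apply: le_trans (dot_young u v k0) _; rewrite -!sqr_norm2 le_eqVlt; apply/orP; left.
by apply/eqP; field; rewrite u0 v0.
Qed.

(** Exact strong convexity of the squared distance: the defect is independent of the centre [w], so
    proximal terms with different centres add up. *)
Lemma dot_conv k u v w :
  dot (k *: u + (1 - k) *: v - w) (k *: u + (1 - k) *: v - w) =
  k * dot (u - w) (u - w) + (1 - k) * dot (v - w) (v - w)
  - k * (1 - k) * dot (u - v) (u - v).
Proof. by rewrite !dotE (dotC v u) (dotC w u) (dotC w v); ring. Qed.

(** * Convexity, gradients and growth at a minimizer *)

Lemma convex_setP (A : set 'rV[R]_n) k u v :
  convex_set A -> 0 <= k <= 1 -> A u -> A v -> A (k *: u + (1 - k) *: v).
Proof.
move=> cA /andP[k0 k1] Au Av; apply/set_mem.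
exact: (cA u v (Itv01 k0 k1)) (mem_set Au) (mem_set Av).
Qed.

Lemma convex_functionP (f : 'rV[R]_n -> R) k u v :
  convex_function (setT : set 'rV[R]_n) f -> 0 <= k <= 1 ->
  f (k *: u + (1 - k) *: v) <= k * f u + (1 - k) * f v.
Proof.
move=> cf /andP[k0 k1].
exact: (cf (Itv01 k0 k1) u v (mem_set I) (mem_set I)).
Qed.

Lemma derive_gradient (f : 'rV[R]_n -> R) u v :
  differentiable f u -> 'D_v f u = dot (gradient f u) v.
Proof.
move=> df; rewrite deriveE// {1}(row_sum_delta v) linear_sum.
by apply: eq_bigr => i _; rewrite linearZ mxE deriveE//= mulrC.
Qed.

(** Convexity bounds each right difference quotient at [u] towards [v] by [f v - f u]; the bound
    passes to the limit. *)
Lemma convex_gradient_le (f : 'rV[R]_n -> R) u v :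
  convex_function (setT : set 'rV[R]_n) f -> differentiable f u ->
  f u + dot (gradient f u) (v - u) <= f v.
Proof.
move=> cf df; rewrite -derive_gradient// -lerBrDl.
have /cvg_dnbhs_at_right cvgD := @diff_derivable _ _ _ _ _ (v - u) df.
apply: (cvgr_to_le cvgD); near=> k.
have k0 : 0 < k by near: k; exact: nbhs_right_gt.
have k1 : k <= 1 by near: k; apply: nbhs_right_le.
rewrite (_ : _ *: _ = k^-1 * (f (k *: (v - u) + u) - f u))// ler_pdivrMl//.
have -> : k *: (v - u) + u = k *: v + (1 - k) *: u.
  by rewrite scalerBr scalerBl scale1r addrAC addrA.
by have := @convex_functionP f k v u cf; rewrite k1 ltW// => /(_ isT); lra.
Unshelve. all: by end_near. Qed.

(** Minimality against [k *: v + (1 - k) *: u], divided by [k], gives the claim up to an error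
    proportional to [k]. *)
Lemma argmin_quadratic_growth (A : set 'rV[R]_n) (h : 'rV[R]_n -> R) c u v :
  convex_set A -> 0 <= c ->
  (forall k, 0 <= k <= 1 -> h (k *: v + (1 - k) *: u) <=
     k * h v + (1 - k) * h u - c * (k * (1 - k)) * dot (v - u) (v - u)) ->
  argmin A h u -> A v -> h u + c * dot (v - u) (v - u) <= h v.
Proof.
move=> cA c0 hconv [Au hmin] Av; set d := dot _ _ in hconv *.
have d0 : 0 <= d := dot_ge0 _.
apply/ler_addgt0Pr => e e0.
have cd0 : 0 <= c * d by rewrite mulr_ge0.
have cde : 0 < c * d + e by rewrite ltr_wpDl.
(* Makes the error [k * (c * d)] at most [e], with [k] in [(0, 1]] even when [c * d = 0]. *)
set k := e / (c * d + e).
have k0 : 0 < k by rewrite divr_gt0.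
have k1 : k <= 1 by rewrite ler_pdivrMr// mul1r lerDr.
have kI : 0 <= k <= 1 by rewrite ltW.
have ke : k * (c * d) <= e.
  by rewrite /k mulrAC ler_pdivrMr// ler_wpM2l ?lerDl// ltW.
have := le_trans (hmin _ (convex_setP cA kI Av Au)) (hconv _ kI).
have -> : k * h v + (1 - k) * h u - c * (k * (1 - k)) * d =
   h u + k * (h v - h u - c * d + k * (c * d)) by ring.
rewrite lerDl pmulr_rge0//; lra.
Qed.

End Euclidean.

(** * Queue drift, strong convexity of the objective, tracking sums *)

Section DtcOco.
Variables (R : realType) (n C : nat).

(** The right side is [(q + a) ^+ 2 + a ^+ 2], which dominates the square of either branch. *)
Lemma sqr_max_drift (q a : R) :
  Num.max (- a) (q + a) ^+ 2 <= q ^+ 2 + 2 * (q * a) + 2 * a ^+ 2.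
Proof.
have h1 := sqr_ge0 (q + a); have h2 := sqr_ge0 a.
by case: (leP (- a) (q + a)) => _; nra.
Qed.

Lemma queue_drift (p q a : 'rV[R]_C) :
  (forall c, p 0 c = Num.max (- a 0 c) (q 0 c + a 0 c)) ->
  dot p p <= dot q q + 2 * dot q a + 2 * dot a a.
Proof.
move=> pE; rewrite /dot !mulr_sumr -!big_split; apply: ler_sum => c _ /=.
by rewrite -!expr2 pE sqr_max_drift.
Qed.

(** The gradient term is affine, nonnegative weights keep the constraint term convex, and the two
    quadratics supply the modulus [alpha + eta] through [dot_conv]. *)
Lemma dtc_oco_objective_convex (tau : nat)
    (f : nat -> 'rV[R]_n -> R) (g : nat -> 'rV[R]_n -> 'rV[R]_C)
    (alpha eta gamma : R) (x : nat -> 'rV[R]_n) (Q : nat -> 'rV[R]_C)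
    (t : nat) (u v : 'rV[R]_n) (k : R) :
  0 <= gamma ->
  (forall c, convex_function (setT : set 'rV[R]_n)
    (fun y => g (t - tau)%N y 0 c)) ->
  (forall c, 0 <= (Q t.-1 + gamma *: g (t - tau).-1 (x t.-1)) 0 c) ->
  0 <= k <= 1 ->
  let h := dtc_oco_objective tau f g alpha eta gamma x Q t in
  h (k *: v + (1 - k) *: u) <=
  k * h v + (1 - k) * h u - (alpha + eta) * (k * (1 - k)) * dot (v - u) (v - u).
Proof.
move=> gamma0 cvxg; rewrite /dtc_oco_objective; set W := Q _ + _ => W0 kI /=.
move: W W0 => W W0.
rewrite !sqr_norm2 !dot_conv; set s := (t - tau)%N in cvxg *.
have : dot W (gamma *: g s (k *: v + (1 - k) *: u)) <=
    k * dot W (gamma *: g s v) + (1 - k) * dot W (gamma *: g s u).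
  rewrite /dot !mulr_sumr -big_split; apply: ler_sum => c _ /=; rewrite !mxE.
  rewrite [leRHS](_ : _ = W 0 c * (gamma * (k * g s v 0 c + (1 - k) * g s u 0 c))).
    by rewrite !ler_wpM2l// (convex_functionP _ _ (cvxg c)).
  by ring.
move: (dot W _) (dot W _) (dot W _) => a b c abc.
by rewrite !dotE; nra.
Qed.

(** Inserting [|xs i - y i|^2] splits each summand into a telescoping difference and the effect of
    moving [xs i] to [xs i.+1] with [y i] fixed; only the latter costs path length. *)
Lemma tracking_telescope (A : set 'rV[R]_n) (Rad : R) (xs y : nat -> 'rV[R]_n)
    (T : nat) :
  (forall u v, A u -> A v -> norm2 (u - v) <= Rad) ->
  (forall i, A (xs i)) -> (forall i, A (y i)) ->
  \sum_(0 <= i < T) (dot (xs i.+1 - y i) (xs i.+1 - y i) -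
                     dot (xs i.+1 - y i.+1) (xs i.+1 - y i.+1)) <=
  Rad ^+ 2 + 2 * Rad * path_length xs T.
Proof.
move=> diam Axs Ay; pose d i := dot (xs i - y i) (xs i - y i).
have d0 : d 0%N <= Rad ^+ 2 by apply/sqr_norm2_le/diam.
suff : \sum_(0 <= i < T) (dot (xs i.+1 - y i) (xs i.+1 - y i) - d i.+1) <=
    \sum_(0 <= i < T)
      (2 * Rad * norm2 (xs i.+1 - xs i) - (d i.+1 - d i)).
  move=> /le_trans; apply; rewrite sumrB telescope_sumr// -mulr_sumr.
  have := dot_ge0 (xs T - y T); rewrite -/(d T).
  by rewrite /path_length big_add1/=; lra.
apply: ler_sum => i _; set u := xs i.+1 - xs i.
(* Difference of squares: [|a|^2 - |b|^2 = (a - b).(a + b)] with [a - b = u]. *)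
have E : dot (xs i.+1 - y i) (xs i.+1 - y i) - d i =
    dot u (xs i.+1 - y i) + dot u (xs i - y i).
  by rewrite /d /u !dotE (dotC (xs i) (xs i.+1)) (dotC (y i)) (dotC (y i)); ring.
have bnd v : norm2 v <= Rad -> dot u v <= norm2 u * Rad.
  by move=> vR; rewrite (le_trans (dot_le_norm2 u v))// ler_wpM2l ?norm2_ge0.
have := bnd _ (diam _ _ (Axs i.+1) (Ay i)).
have := bnd _ (diam _ _ (Axs i) (Ay i)).
by lra.
Qed.

End DtcOco.

Theorem theorem4 (R : realType) (n C T tau : nat)
    (X0 : set 'rV[R]_n)
    (f : nat -> 'rV[R]_n -> R) (g : nat -> 'rV[R]_n -> 'rV[R]_C)
    (D beta G eps Rad alpha eta gamma : R)
    (x : nat -> 'rV[R]_n) (Q : nat -> 'rV[R]_C) (xs : nat -> 'rV[R]_n)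
    (hT : (1 <= T)%N) (htau : (1 <= tau)%N)
    (hX0_compact : compact X0)
    (hX0_convex : convex_set X0)
    (hf_convex : forall t, (1 <= t)%N ->
       convex_function (setT : set 'rV[R]_n) (f t))
    (hf_diff : forall t, (1 <= t)%N -> forall y, differentiable (f t) y)
    (hg_convex : forall t, (1 <= t)%N -> forall c : 'I_C,
       convex_function (setT : set 'rV[R]_n) (fun y => g t y 0 c))
    (hD : 0 < D)
    (assumption1 : forall t, (1 <= t)%N -> forall y, X0 y ->
       norm2 (gradient (f t) y) <= D)
    (hbeta : 0 < beta)
    (assumption2_1 : forall t, (1 <= t)%N -> forall y z, X0 y -> X0 z ->
       norm2 (g t y - g t z) <= beta * norm2 (y - z))
    (hG : 0 < G)
    (assumption2_2 : forall t, (1 <= t)%N -> forall y, X0 y ->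
       norm2 (g t y) <= G)
    (heps : 0 < eps)
    (assumption2_3 : forall t, (1 <= t)%N ->
       exists2 y, X0 y & forall c, g t y 0 c <= - eps)
    (hRad : 0 < Rad)
    (assumption3 : forall y z, X0 y -> X0 z -> norm2 (y - z) <= Rad)
    (halpha : 0 < alpha) (hgamma : 0 < gamma)
    (heta : gamma ^+ 2 * beta ^+ 2 <= eta)
    (halgo : dtc_oco tau X0 f g alpha eta gamma x Q)
    (hxs : dynamic_benchmark X0 f g xs) :
  dynamic_regret f x xs T <=
    D ^+ 2 / (4 * alpha) * T%:R + gamma ^+ 2 * G ^+ 2 / 2
    + gamma ^+ 2 * constraint_variation X0 g T
    + (alpha * tau%:R + eta) * (Rad ^+ 2 + 2 * Rad * path_length xs T)
    + D * Rad * tau%:R.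

(* Index shift and bounds on the constraints *)
Proof.
case: halgo => hx hQ hg0 hdec hque; case: hxs => hxs0 hxs.
have X0x s : (1 <= s)%N -> X0 (x s).
  move=> s1; have [st|ts] := leqP s tau; first by apply: hx; rewrite s1.
  by case: (hdec s ts).
have X0xs i : X0 (xs i) by case: i => // i; case: (hxs i.+1 isT) => [[]].
(* In the notation of the overview, [A i] is [a_(i + tau)]. *)
pose A i := gamma *: g i (x (i + tau)%N).
have tauK i : ((i + tau).+1 - tau = i.+1)%N by rewrite -addSn addnK.
have QE i c : Q (i + tau).+1 0 c =
    Num.max (- A i.+1 0 c) (Q (i + tau)%N 0 c + A i.+1 0 c).
  by rewrite hque ?ltnS ?leq_addl// tauK mxE.
(* At [i = 0] both terms vanish by initialization; afterwards the first branch of the maximum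
   suffices. *)
have QA0 i c : 0 <= (Q (i + tau)%N + A i) 0 c.
  case: i => [|i]; first by rewrite hQ ?htau ?leqnn// add0r mxE hg0 mxE mulr0.
  by rewrite mxE addSn QE -lerBlDr sub0r le_max lexx.
have gdiff2 i y z : X0 y -> X0 z ->
    dot (g i.+1 y - g i.+1 z) (g i.+1 y - g i.+1 z) <=
    beta ^+ 2 * dot (y - z) (y - z).
  move=> Xy Xz; rewrite -(sqr_norm2 (y - z)) -exprMn.
  by apply: sqr_norm2_le; exact: assumption2_1.
have gbnd i y : X0 y -> dot (g i y) (g i y) <= G ^+ 2.
  case: i => [_|i Xy]; last by apply: sqr_norm2_le; exact: assumption2_2.
  by rewrite hg0 -(scale0r 0) dotZl mul0r sqr_ge0.
pose V i := sup [set norm2 (g i.+1 y - g i y) ^+ 2 | y in X0].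
have le_V i y : X0 y -> dot (g i.+1 y - g i y) (g i.+1 y - g i y) <= V i.
  move=> Xy; rewrite -sqr_norm2; apply: ub_le_sup; last by exists y.
  (* The supremum dominates its set only once that set is bounded; [|a - b|^2 <= 2 |a|^2 + 2 |b|^2]
     gives this constant. *)
  exists (4 * G ^+ 2) => _ [z Xz <-]; rewrite sqr_norm2.
  have := gbnd i z Xz; have := gbnd i.+1 z Xz.
  have := dot_ge0 (g i.+1 z + g i z).
  by rewrite !dotE (dotC (g i z)); lra.

(* Regret of a single round *)
pose d (u v : 'rV[R]_n) : R := dot (u - v) (u - v).
have slot i : f i.+1 (x i.+1) - f i.+1 (xs i.+1) <=
    D ^+ 2 / (4 * alpha) + gamma ^+ 2 * V i
    + (dot (Q (i + tau)%N) (Q (i + tau)%N)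
       - dot (Q (i.+1 + tau)%N) (Q (i.+1 + tau)%N)) / 2
    + (dot (A i.+1) (A i.+1) - dot (A i) (A i)) / 2
    + alpha * (d (xs i.+1) (x i.+1) - d (xs i.+1) (x (i.+1 + tau)%N))
    + eta * (d (xs i.+1) (x (i + tau)%N) - d (xs i.+1) (x (i.+1 + tau)%N)).
  (* Here [tau >= 1] matters: at [i = 0] it keeps the index away from the unconstrained [x 0]. *)
  have Xxi : X0 (x (i + tau)%N) by apply/X0x/ltn_addl.
  have tau_lt : (tau < (i + tau).+1)%N by rewrite ltnS leq_addl.
  have ae0 : 0 <= alpha + eta.
    by rewrite addr_ge0 ?(ltW halpha)// (le_trans _ heta)// mulr_ge0 ?sqr_ge0.
  have cvxg c : convex_function (setT : set 'rV[R]_n)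
      (fun y => g ((i + tau).+1 - tau)%N y 0 c) by rewrite tauK; exact: hg_convex.
  have W0 c : 0 <= (Q (i + tau)%N +
      gamma *: g ((i + tau).+1 - tau).-1 (x (i + tau)%N)) 0 c by rewrite tauK.
  have := argmin_quadratic_growth hX0_convex ae0
    (fun k =>
       @dtc_oco_objective_convex _ _ _ tau f g alpha eta gamma x Q (i + tau).+1
         _ _ k (ltW hgamma) cvxg W0)
    (hdec _ tau_lt) (X0xs i.+1).
  rewrite /dtc_oco_objective tauK /= !sqr_norm2 -/(A i) -(addSn i tau).
  set W := Q _ + A i; set s := i.+1; set t := (s + tau)%N; rewrite -/(A s) -/t.
  have Xxt : X0 (x t) by exact: X0x.
  have Xxs : X0 (x s) by exact: X0x.
  have grad : f s (x s) + dot (gradient (f s) (x s)) (xs s - x s) <= f s (xs s).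
    by apply: convex_gradient_le; [exact: hf_convex|exact: hf_diff].
  (* Weight [alpha] makes the quadratic term cancel the proximal term around [x s]. *)
  have young := dot_young (- gradient (f s) (x s)) (x t - x s) halpha.
  have gradD : dot (gradient (f s) (x s)) (gradient (f s) (x s)) / (4 * alpha)
      <= D ^+ 2 / (4 * alpha).
    by rewrite ler_pM2r ?invr_gt0 ?mulr_gt0//; apply/sqr_norm2_le/assumption1.
  have feas : dot W (gamma *: g s (xs s)) <= 0.
    apply: sumr_le0 => c _; apply: mulr_ge0_le0; first exact: QA0.
    rewrite mxE pmulr_rle0//; by case: (hxs s isT) => -[].
  have drift : dot (Q t) (Q t) <= dot (Q (i + tau)%N) (Q (i + tau)%N)
      + 2 * dot (Q (i + tau)%N) (A s) + 2 * dot (A s) (A s).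
    by apply: queue_drift => c; exact: QE.
  have var : dot (A s - A i) (A s - A i) / 2 <=
      eta * d (x t) (x (i + tau)%N) + gamma ^+ 2 * V i.
    (* [p] moves the point under a fixed constraint and is absorbed through
       [gamma ^+ 2 * beta ^+ 2 <= eta]; [q] changes the constraint at a fixed point. The factor 1/2
       pays for [|p + q|^2 <= 2 |p|^2 + 2 |q|^2]. *)
    set p := g s (x t) - g s (x (i + tau)%N).
    set q := g s (x (i + tau)%N) - g i (x (i + tau)%N).
    have -> : A s - A i = gamma *: (p + q) by rewrite /p /q addrA subrK scalerBr.
    have hp : gamma ^+ 2 * dot p p <= eta * d (x t) (x (i + tau)%N).
      have := ler_wpM2r (dot_ge0 (x t - x (i + tau)%N)) heta.
      by apply: le_trans; rewrite -(mulrA (gamma ^+ 2)) ler_wpM2l ?sqr_ge0 ?gdiff2.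
    have hq : gamma ^+ 2 * dot q q <= gamma ^+ 2 * V i.
      by rewrite ler_wpM2l ?sqr_ge0 ?le_V.
    move: p q hp hq => p q hp hq.
    have := mulr_ge0 (sqr_ge0 gamma) (dot_ge0 (p - q)).
    by rewrite !dotE (dotC q p); nra.
  rewrite !dotNl dotNr opprK in young.
  rewrite dot_sqrB in var.
  have WA : dot W (A s) = dot (Q (i + tau)%N) (A s) + dot (A s) (A i).
    by rewrite dotDl (dotC (A i)).
  by rewrite WA -!/(d _ _) in young *; lra.

(* Summation over the rounds *)
have sumE : \sum_(0 <= i < T) (f i.+1 (x i.+1) - f i.+1 (xs i.+1)) =
  dynamic_regret f x xs T by rewrite /dynamic_regret big_add1.
have sumV : \sum_(0 <= i < T) V i = constraint_variation X0 g T.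
  by rewrite /constraint_variation big_add1.
have tele (h : nat -> R) : \sum_(0 <= i < T) (h i - h i.+1) = h 0%N - h T.
  rewrite -opprB -(telescope_sumr h (leq0n T)) -sumrN.
  by apply: eq_bigr => i _; rewrite opprB.
have sumeta : \sum_(0 <= i < T)
    (d (xs i.+1) (x (i + tau)%N) - d (xs i.+1) (x (i.+1 + tau)%N)) <=
    Rad ^+ 2 + 2 * Rad * path_length xs T.
  apply: (tracking_telescope (y := fun i => x (i + tau)%N)) assumption3 X0xs _ => i.
  exact/X0x/ltn_addl.
have sumalpha : \sum_(0 <= i < T)
    (d (xs i.+1) (x i.+1) - d (xs i.+1) (x (i.+1 + tau)%N)) <=
    tau%:R * (Rad ^+ 2 + 2 * Rad * path_length xs T).
  under eq_bigr => i _.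
    (* A gap of [tau] rounds becomes [tau] unit steps; after exchanging sums, each offset [k] is one
       tracking sum. *)
    have -> : d (xs i.+1) (x i.+1) - d (xs i.+1) (x (i.+1 + tau)%N) =
      \sum_(0 <= k < tau) (d (xs i.+1) (x (i.+1 + k)%N)
                          - d (xs i.+1) (x (i.+1 + k).+1)).
      under eq_bigr do rewrite -addnS -opprB.
      rewrite sumrN (telescope_sumr (fun k => d (xs i.+1) (x (i.+1 + k)%N)))//.
      by rewrite addn0 opprB.
    over.
  rewrite exchange_big mulr_natl -[X in _ *+ X]subn0 -sumr_const_nat /=.
  apply: ler_sum => k _.
  exact: (tracking_telescope (y := fun i => x (i.+1 + k)%N) T assumption3 X0xs
    (fun i => X0x (i.+1 + k)%N isT)).
rewrite -sumE (le_trans (ler_sum _ (fun i _ => slot i)))//.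
rewrite !big_split/= sumr_const_nat subn0 -(mulr_natr (D ^+ 2 / (4 * alpha))).
rewrite -!mulr_suml -!mulr_sumr sumV.
rewrite (tele (fun i => dot (Q (i + tau)%N) (Q (i + tau)%N))).
rewrite (telescope_sumr (fun i => dot (A i) (A i)))//.
rewrite add0n hQ ?htau ?leqnn// -[X in dot X X](scale0r 0) dotZl mul0r.
(* Source of [gamma ^+ 2 * G ^+ 2 / 2]: the only telescoped endpoint that enters with a positive
   sign and does not vanish by initialization. *)
have AT : dot (A T) (A T) <= gamma ^+ 2 * G ^+ 2.
  rewrite dotZl dotZr mulrA -expr2 ler_wpM2l ?sqr_ge0//.
  exact/gbnd/X0x/(leq_trans hT)/leq_addr.
have A0 := dot_ge0 (A 0%N); have QT := dot_ge0 (Q (T + tau)%N).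
have eta0 : 0 <= eta by rewrite (le_trans _ heta)// mulr_ge0 ?sqr_ge0.
have := ler_wpM2l (ltW halpha) sumalpha; have := ler_wpM2l eta0 sumeta.
(* Pairing round [s] with decision round [s + tau] covers all [s] up to [T], so this term enters
   only through its sign. *)
have : 0 <= D * Rad * tau%:R by rewrite !mulr_ge0 ?ler0n // ltW.
by lra.
Qed.
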